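(* Let $\mathcal{B}$ be a simple, regular, $C^1$ composite Bézier curve in $\mathbb{R}^3$. Sufficiently many subdivisions yield a simple control polygon that is homeomorphic to $\mathcal{B}$: there exists an integer $i_0\ge0$ such that for every $i\ge i_0$ the control polygon of $\mathcal{B}$ obtained after $i$ subdivisions is simple and homeomorphic to $\mathcal{B}$.
   Context: A Bézier curve of degree $n\ge 1$ with control points $p_0,\dots,p_n\in\mathbb{R}^3$ is $t\mapsto\sum_{j=0}^n\binom nj t^j(1-t)^{n-j}p_j$, $t\in[0,1]$; the PL curve through $p_0,\dots,p_n$ is its control polygon. A composite Bézier curve $\mathcal{B}:[0,1]\to\mathbb{R}^3$ is made of $m\ge1$ Bézier segments of common degree $n$ joined at common end points, the $s$-th segment (affinely reparametrized) occupying the parameter interval $[\frac{s-1}{m},\frac sm]$. A curve is simple if it is non-self-intersecting (injective, except that initial and terminal points may coincide, in which case the curve is closed); regular means the first derivative never vanishes; $C^1$ means continuously differentiable on $[0,1]$, with $\mathcal{B}'(0)=\mathcal{B}'(1)$ if the curve is closed. Subdivision is the de Casteljau algorithm with parameter $\frac12$: for a control polygon $(q_0,\dots,q_n)$ put $q_j^0=q_j$ and $q_j^l=\frac12(q_j^{l-1}+q_{j+1}^{l-1})$; one subdivision replaces it by the two polygons $(q_0^0,q_0^1,\dots,q_0^n)$ and $(q_0^n,q_1^{n-1},\dots,q_n^0)$. After $i$ iterations applied to every segment there are $K=m2^i$ sub-control polygons $P^1,\dots,P^K$, where $P^k$ is the control polygon of the part of $\mathcal{B}$ over $[\frac{k-1}K,\frac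 kK]$ and the last vertex of $P^k$ is the first vertex of $P^{k+1}$. Their union is the control polygon of $\mathcal{B}$ after $i$ subdivisions. *)

(* Defs.v *)
From mathcomp Require Import all_boot all_order all_algebra.
From mathcomp Require Import all_classical all_reals all_analysis.

Set Implicit Arguments.
Unset Strict Implicit.
Unset Printing Implicit Defensive.

Import Order.TTheory GRing.Theory Num.Theory.
Import numFieldNormedType.Exports.

Local Open Scope classical_set_scope.
Local Open Scope ring_scope.

(* Curves are functions R -> V of which only the values on [0, 1] matter.
   A polygon of degree n is a sequence q : nat -> V of which only q 0, ..., q n
   matter; a family of m polygons is P : nat -> nat -> V, of which only
   P 0, ..., P m.-1 matter: polygons are indexed from 0. *)

Section Curves.
Context {R : realType} {V : lmodType R}.
Implicit Types (q : nat -> V) (P : nat -> nat -> V).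

(* The curve on [0, 1] running through c 0, ..., c m.-1, with c s reparametrized
   affinely from [0, 1] to [s / m, (s + 1) / m]; the minimum makes t = 1
   belong to the last piece. *)
Definition concat_curves (m : nat) (c : nat -> R -> V) (t : R) : V :=
  let s := minn (Num.truncn (m%:R * t)) m.-1 in c s (m%:R * t - s%:R).

Definition bezier (n : nat) q (t : R) : V :=
  \sum_(j < n.+1) ('C(n, j)%:R * t ^+ j * (1 - t) ^+ (n - j)) *: q j.

Definition polyline (n : nat) q : R -> V :=
  concat_curves n (fun j t => (1 - t) *: q j + t *: q j.+1).

Definition joined (m n : nat) P : Prop :=
  forall s, (s.+1 < m)%N -> P s n = P s.+1 0%N.

Definition composite_bezier (m n : nat) P : R -> V :=
  concat_curves m (fun s => bezier n (P s)).

Definition composite_polyline (m n : nat) P : R -> V :=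
  concat_curves m (fun s => polyline n (P s)).

(* de_casteljau q l j is q_j^l *)
Fixpoint de_casteljau q (l j : nat) : V :=
  if l is l'.+1
  then 2^-1 *: (de_casteljau q l' j + de_casteljau q l' j.+1)
  else q j.

Definition subdiv_left q (j : nat) : V := de_casteljau q j 0.

Definition subdiv_right (n : nat) q (j : nat) : V := de_casteljau q (n - j) j.

(* Polygon k is replaced by the polygons number 2k and 2k + 1. *)
Definition subdivide (n : nat) P (k : nat) : nat -> V :=
  if odd k then subdiv_right n (P k./2) else subdiv_left (P k./2).

Definition subdivided (n : nat) P (i : nat) : nat -> nat -> V :=
  iter i (subdivide n) P.

Definition control_polygon (m n : nat) P (i : nat) : R -> V :=
  composite_polyline (m * 2 ^ i) n (subdivided n P i).

Definition simple_curve (f : R -> V) : Prop :=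
  forall s t : R, 0 <= s -> s < t -> t <= 1 -> f s = f t -> s = 0 /\ t = 1.

Definition closed_curve (f : R -> V) : Prop := f 0 = f 1.

End Curves.

Section Smoothness.
Context {R : realType} {V : normedModType R}.
Implicit Types (f : R -> V).

(* Derivative of f as a function on [0, 1], one-sided at the end points. *)
Definition has_deriv01 f (t : R) (v : V) : Prop :=
  (u - t)^-1 *: (f u - f t) @[u --> within `[0, 1] (dnbhs t)] --> v.

Definition C1_curve f : Prop :=
  exists df : R -> V,
    [/\ forall t : R, t \in `[0, 1] -> has_deriv01 f t (df t),
        {within `[0, 1], continuous df}
      & closed_curve f -> df 0 = df 1].

Definition regular_curve f : Prop :=
  forall (t : R) (v : V), t \in `[0, 1] -> has_deriv01 f t v -> v != 0.

End Smoothness.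

(* A and B are homeomorphic for their subspace topologies. *)
Definition homeomorphic {T U : topologicalType} (A : set T) (B : set U) : Prop :=
  exists (f : T -> U) (g : U -> T),
    [/\ set_fun A B f, set_fun B A g, {in A, cancel f g} & {in B, cancel g f}]
    /\ {within A, continuous f} /\ {within B, continuous g}.

(* Main.v *)
From HB Require Import structures.
Require Import Defs.
From mathcomp Require Import all_boot all_order all_algebra.
From mathcomp Require Import all_classical all_reals all_analysis.
From mathcomp Require Import lra ring zify.

Import Order.TTheory GRing.Theory Num.Theory.
Import numFieldNormedType.Exports.

Local Open Scope classical_set_scope.
Local Open Scope ring_scope.

Set Implicit Arguments.
Unset Strict Implicit.
Unset Printing Implicit Defensive.

(** Let B be the composite curve and C_i its control polygon after i
    subdivisions, both parametrized by [0, 1] so that the polygon number k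
    runs over the same interval as the piece of B that it controls.

    The idea is that C_i is close to B in the C^1 sense, which here means that
    C_i - B is a Lipschitz function whose constant tends to 0
    ([control_polygon_converges]).  On the piece number k, both the polygon
    and the Bezier curve have all their velocities close to n times the first
    edge of the polygon, with an error governed by the second differences of
    its vertices ([polygon_near_bezier]).  One subdivision divides the second
    differences by 4 ([bend_subdivide]) while it only doubles the number of
    pieces, that is, the speed of the reparametrization; so the error is
    O(2^-i).

    On the other side, compactness and the mean value inequality show that a
    simple regular C^1 curve satisfies a chord-arc inequality ([chord_arc]):
    |B t - B s| is at least c times the distance of the parameters s and t,
    where for a closed curve the distance is measured on the circle obtained
    by gluing 0 to 1.  As C_i and B have the same end points, a Lipschitz
    constant at most c / 2 for C_i - B makes the chord of C_i between any two
    parameters differ from that of B by at most half the length of the latter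
    ([perturbation_comparable]).  Hence C_i identifies exactly the same
    parameters as B, so that it is simple, and the correspondence B t <-> C_i t
    between the two images is well defined and Lipschitz in both directions:
    it is a homeomorphism ([homeomorphic_images]).

    The facts on Bezier curves come from one device, [umbral]: replacing 'X^j
    by the control point q_j turns the Bezier curve into the polynomial
    (1 - t + t X)^n, the de Casteljau midpoint into (1 + X) / 2, and the
    difference operator into multiplication by X - 1, so that subdivision and
    its effect on differences become identities between polynomials. *)

(** * Umbral calculus for Bezier curves and subdivision *)

Section ShiftCalculus.
Context {R : realType} {V : lmodType R}.
Implicit Types (q : nat -> V) (p A B : {poly R}).

(** The linear map {poly R} -> V with 'X^j |-> q j. Multiplication by 'X
    becomes the shift of the sequence. *)
Definition umbral q p : V := \sum_(j < size p) p`_j *: q j.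

Lemma umbral_wide q p N : (size p <= N)%N ->
  umbral q p = \sum_(j < N) p`_j *: q j.
Proof.
move=> pN; rewrite /umbral (big_ord_widen N (fun j => p`_j *: q j) pN).
rewrite [RHS](bigID (fun j : 'I_N => (j < size p)%N)) /=.
rewrite [X in _ + X]big1 ?addr0// => j; rewrite -leqNgt => pj.
by rewrite nth_default// scale0r.
Qed.

Lemma umbral_is_linear q : linear (umbral q).
Proof.
move=> a p p'; set N := maxn (size p) (size p').
have size_lin : (size (a *: p + p' : {poly R})%R <= N)%N.
  rewrite (leq_trans (size_polyD _ _))// geq_max leq_maxr andbT.
  by rewrite (leq_trans (size_scale_leq _ _))// leq_maxl.
rewrite (umbral_wide q size_lin) (@umbral_wide q p N) ?leq_maxl//.
rewrite (@umbral_wide q p' N) ?leq_maxr// scaler_sumr -big_split /=.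
by apply: eq_bigr => j _; rewrite coefD coefZ scalerDl scalerA.
Qed.

HB.instance Definition _ q :=
  GRing.isLinear.Build R {poly R} V _ (umbral q) (umbral_is_linear q).

Lemma umbralXn q j : umbral q 'X^j = q j.
Proof.
rewrite /umbral size_polyXn big_ord_recr /= coefXn eqxx scale1r big1 ?add0r//.
by move=> i _; rewrite coefXn ltn_eqF// scale0r.
Qed.

Lemma umbral1 q : umbral q 1 = q 0%N.
Proof. by rewrite -(expr0 'X) umbralXn. Qed.

Lemma umbralXM q p : umbral q ('X * p) = umbral (q \o succn) p.
Proof.
rewrite [LHS](@umbral_wide _ _ (size p).+1); last first.
  by rewrite (leq_trans (size_polyMleq _ _))// size_polyX.
rewrite big_ord_recl coefXM eqxx scale0r add0r.
by apply: eq_bigr => j _; rewrite coefXM.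
Qed.

Lemma umbralB_seq q q' p :
  umbral (fun j => q j - q' j) p = umbral q p - umbral q' p.
Proof.
by rewrite /umbral -sumrB; apply: eq_bigr => j _; rewrite scalerBr.
Qed.

Lemma umbral_cst (v : V) p : umbral (fun=> v) p = p.[1] *: v.
Proof.
rewrite /umbral -scaler_suml horner_coef; congr (_ *: _).
by apply: eq_bigr => j _; rewrite expr1n mulr1.
Qed.

Definition delta q j : V := q j.+1 - q j.

Lemma umbral_delta q p : umbral q (('X - 1) * p) = umbral (delta q) p.
Proof.
by rewrite mulrBl mul1r linearB /= umbralXM -umbralB_seq.
Qed.

(** The binomial formula for ((1 - t) A + t B)^n. With A = 1 and B = 'X it
    describes the Bezier curve of q itself; the two halves of a subdivided
    polygon are the cases (1, mid) and (mid, 'X). *)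
Lemma bezier_umbral n q q' A B t :
  (forall j, (j <= n)%N -> q' j = umbral q (A ^+ (n - j) * B ^+ j)) ->
  bezier n q' t = umbral q (((1 - t) *: A + t *: B) ^+ n).
Proof.
move=> q'E; rewrite exprDn linear_sum; apply: eq_bigr => j _.
rewrite q'E -1?ltnS// -linearZ /=; congr (umbral q _).
have scaleM (a b : R) (p p' : {poly R}) :
  (a *: p) * (b *: p') = (a * b) *: (p * p').
  by rewrite -!mul_polyC polyCM; ring.
by rewrite !exprZn scaleM -[RHS]scaler_nat scalerA; congr (_ *: _); ring.
Qed.

(** A step of the de Casteljau algorithm is the mean of a sequence and its
    shift. *)
Definition mid : {poly R} := 2^-1 *: (1 + 'X).

Lemma de_casteljauE q l j :
  de_casteljau q l j = umbral q (mid ^+ l * 'X^j).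
Proof.
elim: l j => [|l IH] j; first by rewrite mul1r umbralXn.
rewrite /= !IH -linearD -linearZ /=; congr (umbral q _).
by rewrite !exprS /mid -!scalerAl; congr (_ *: _); ring.
Qed.

Lemma subdiv_leftE q j : subdiv_left q j = umbral q (mid ^+ j).
Proof. by rewrite /subdiv_left de_casteljauE mulr1. Qed.

Lemma subdiv_rightE n q j :
  subdiv_right n q j = umbral q (mid ^+ (n - j) * 'X^j).
Proof. exact: de_casteljauE. Qed.

Lemma bezierE n q t :
  bezier n q t = umbral q (((1 - t)%:P + t *: 'X) ^+ n).
Proof.
rewrite (@bezier_umbral n q q 1 'X) ?alg_polyC// => j _.
by rewrite expr1n mul1r umbralXn.
Qed.

Lemma bezier_subdiv_left n q t :
  bezier n (subdiv_left q) t = bezier n q (t / 2).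
Proof.
rewrite (@bezier_umbral n q (subdiv_left q) 1 mid); last first.
  by move=> j _; rewrite subdiv_leftE expr1n mul1r.
rewrite bezierE /mid -!alg_polyC; congr (umbral q (_ ^+ n)).
by rewrite scalerA scalerDr addrA -scalerDl; congr (_ *: _ + _); field.
Qed.

Lemma bezier_subdiv_right n q t :
  bezier n (subdiv_right n q) t = bezier n q ((1 + t) / 2).
Proof.
rewrite (@bezier_umbral n q (subdiv_right n q) mid 'X); last first.
  by move=> j _; rewrite subdiv_rightE.
rewrite bezierE /mid -!alg_polyC; congr (umbral q (_ ^+ n)).
by rewrite scalerA scalerDr -addrA -scalerDl; congr (_ *: _ + _ *: _); field.
Qed.

Lemma bezier0 n q : bezier n q 0 = q 0%N.
Proof. by rewrite bezierE scale0r addr0 subr0 expr1n umbral1. Qed.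

Lemma bezier1 n q : bezier n q 1 = q n.
Proof. by rewrite bezierE subrr scale1r add0r umbralXn. Qed.

Let half_poly_double : (2^-1)%:P + (2^-1)%:P = 1 :> {poly R}.
Proof. by rewrite -polyCD -polyC1; congr (_%:P); field. Qed.

Lemma mid_sub1 : mid - 1 = 2^-1 *: ('X - 1).
Proof. by rewrite /mid -!mul_polyC -[X in _ - X]half_poly_double; ring. Qed.

Lemma X_sub_mid : 'X - mid = 2^-1 *: ('X - 1).
Proof.
rewrite /mid -!mul_polyC -[X in X - _]mul1r -[X in X * 'X]half_poly_double.
by ring.
Qed.

Let scale_half_sqr (p : {poly R}) : (2^-1 *: p) ^+ 2 = 4^-1 *: p ^+ 2.
Proof. by rewrite exprZn; congr (_ *: _); field. Qed.

Lemma delta2_umbral q p :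
  umbral (delta (delta q)) p = umbral q (('X - 1) ^+ 2 * p).
Proof. by rewrite -!umbral_delta expr2 mulrA. Qed.

(** The second difference along the powers of mid is multiplication by
    (mid - 1)^2, that is, by ('X - 1)^2 / 4: this factor 4 is what makes
    subdivision converge faster than the pieces shrink. *)
Lemma delta2_subdiv_left q j :
  delta (delta (subdiv_left q)) j
    = 4^-1 *: umbral (delta (delta q)) (mid ^+ j).
Proof.
rewrite /delta !subdiv_leftE -!linearB /= -/(delta q) delta2_umbral -linearZ /=.
congr (umbral q _); rewrite scalerAl -scale_half_sqr -mid_sub1 !exprS; ring.
Qed.

Lemma delta2_subdiv_right n q j : (j.+2 <= n)%N ->
  delta (delta (subdiv_right n q)) j
    = 4^-1 *: umbral (delta (delta q)) (mid ^+ (n - j.+2) * 'X^j).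
Proof.
move=> jn; rewrite delta2_umbral /delta !subdiv_rightE -!linearB -linearZ /=.
have -> : (n - j = (n - j.+2).+2)%N by lia.
have -> : (n - j.+1 = (n - j.+2).+1)%N by lia.
congr (umbral q _); rewrite scalerAl -scale_half_sqr -X_sub_mid !exprS; ring.
Qed.
End ShiftCalculus.

(** * Norm estimates by averaging *)

Section Averages.
Context {R : realType} {V : normedModType R}.
Implicit Types (q : nat -> V) (p A B : {poly R}).

(** The polynomials p for which umbral q p is a weighted mean of
    q 0, ..., q N. They are closed under product, which is much easier to see
    here than for iterated means of points. *)
Definition average N p : Prop :=
  [/\ (size p <= N.+1)%N, forall j, 0 <= p`_j & p.[1] = 1].

Lemma average1 : average 0 1.
Proof.
split; rewrite ?size_poly1 ?hornerE// => j.
by rewrite coef1 ler0n.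
Qed.

Lemma averageX : average 1 'X.
Proof.
split; rewrite ?size_polyX ?hornerX// => j.
by rewrite coefX ler0n.
Qed.

Lemma averageM N N' p p' :
  average N p -> average N' p' -> average (N + N') (p * p').
Proof.
move=> [sp p0 p1] [sp' p'0 p'1]; split.
- by rewrite (leq_trans (size_polyMleq _ _))//; lia.
- by move=> j; rewrite coefM sumr_ge0// => i _; rewrite mulr_ge0.
- by rewrite hornerM p1 p'1 mulr1.
Qed.

Lemma averageXn N p k : average N p -> average (k * N) (p ^+ k).
Proof.
move=> pN; elim: k => [|k IH]; first exact: average1.
by rewrite exprS mulSn; exact: averageM.
Qed.

Lemma average_conv t : 0 <= t <= 1 ->
  average 1 ((1 - t)%:P + t *: 'X : {poly R}).
Proof.
move=> /andP[t0 t1]; split.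
- rewrite (leq_trans (size_polyD _ _))// geq_max.
  rewrite (leq_trans (size_polyC_leq1 _))//=.
  by rewrite (leq_trans (size_scale_leq _ _))// size_polyX.
- move=> j; rewrite coefD coefC coefZ coefX addr_ge0 ?mulr_ge0//.
  by case: ifP => _; rewrite ?subr_ge0.
- by rewrite !hornerE; ring.
Qed.

Lemma average_mid : average 1 (mid : {poly R}).
Proof.
have -> : mid = (1 - 2^-1)%:P + 2^-1 *: 'X :> {poly R}.
  rewrite /mid scalerDr alg_polyC; congr (_%:P + _); by field.
by apply: average_conv; apply/andP; split; lra.
Qed.

Lemma norm_umbral_le N q p M : average N p ->
  (forall j, (j <= N)%N -> `|q j| <= M) -> `|umbral q p| <= M.
Proof.
move=> [sp p0 p1] qM; rewrite (umbral_wide q sp).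
rewrite (le_trans (ler_norm_sum _ _ _))//.
rewrite (@le_trans _ _ (\sum_(j < N.+1) p`_j * M))//.
  apply: ler_sum => j _; rewrite normrZ ger0_norm//.
  by rewrite ler_wpM2l// qM// -ltnS.
rewrite -mulr_suml -[leRHS]mul1r -[in leRHS]p1 (horner_coef_wide _ sp).
by under [in leRHS]eq_bigr do rewrite expr1n mulr1.
Qed.

(** The difference of two n-th powers contains the factor Y t - Y s, which is
    (t - s) ('X - 1); the cofactor is a sum of n averages, so the chord of the
    curve is t - s times a sum of n means of edges of the control polygon. *)
Lemma bezier_slope n q v M (s t : R) :
  0 <= s <= 1 -> 0 <= t <= 1 ->
  (forall j, (j < n)%N -> `|delta q j - v| <= M) ->
  `|bezier n q t - bezier n q s - (n%:R * (t - s)) *: v|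
    <= n%:R * M * `|t - s|.
Proof.
move=> s01 t01 qM; rewrite !bezierE -linearB /=.
case: n qM => [|n] qM.
  by rewrite !expr0 subrr linear0 !mul0r scale0r subrr normr0.
set Y := fun t : R => (1 - t)%:P + t *: 'X : {poly R}.
rewrite -/(Y t) -/(Y s) subrXX.
have -> : Y t - Y s = (t - s) *: ('X - 1).
  by rewrite /Y -!mul_polyC !polyCB polyC1; ring.
rewrite -scalerAl linearZ /= umbral_delta (linear_sum (umbral (delta q))) /=.
have -> : (n.+1%:R * (t - s)) *: v = (t - s) *: (n.+1%:R *: v).
  by rewrite scalerA mulrC.
rewrite -scalerBr normrZ mulrC ler_wpM2r//.
have cstE (W : nmodType) (w : W) : w *+ n.+1 = \sum_(i < n.+1) w.
  by rewrite sumr_const card_ord.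
rewrite scaler_nat mulr_natl !cstE -sumrB.
rewrite (le_trans (ler_norm_sum _ _ _))//.
rewrite ler_sum// => i _.
have avg : average n (Y t ^+ (n - i) * Y s ^+ i).
  have := averageM (averageXn (n - i) (average_conv t01))
                   (averageXn i (average_conv s01)).
  by rewrite !muln1 subnK// -ltnS.
have [_ _ avg1] := avg.
rewrite -[X in _ - X]scale1r -avg1 -umbral_cst -umbralB_seq.
by apply: norm_umbral_le avg _ => j jn; exact: qM.
Qed.
End Averages.

(** * Concatenated curves and subdivided composite curves *)

Section Concatenation.
Context {R : realType} {V : lmodType R}.
Implicit Types (c : nat -> R -> V) (P : nat -> nat -> V) (q : nat -> V).

Definition matching m c : Prop :=
  forall a, (a.+1 < m)%N -> c a 1 = c a.+1 0.

(** Thanks to the matching condition a piece is described by its own formula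
    up to its right end point as well, although the concatenation evaluates
    that point on the next piece. *)
Lemma concat_curvesE m c a (t : R) : matching m c -> (a < m)%N ->
  a%:R <= m%:R * t -> m%:R * t <= a.+1%:R ->
  concat_curves m c t = c a (m%:R * t - a%:R).
Proof.
move=> cm am at_ ta; rewrite /concat_curves.
have [tlt|tge] := ltP (m%:R * t) a.+1%:R.
  rewrite (@truncn_def _ _ a) ?at_//.
  by have -> : minn a m.-1 = a by lia.
have tE : m%:R * t = a.+1%:R by apply/le_anti; rewrite ta tge.
rewrite tE natrK; have [ltm|] := ltnP a.+1 m.
  have -> : minn a.+1 m.-1 = a.+1 by lia.
  by rewrite subrr -cm// -natrB// subSnn.
move=> ma; have -> : minn a.+1 m.-1 = a by lia.
by rewrite -natrB// subSnn.
Qed.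

Lemma piece_exists m (t : R) : (0 < m)%N -> 0 <= t <= 1 ->
  exists a, [/\ (a < m)%N, a%:R <= m%:R * t & m%:R * t <= a.+1%:R].
Proof.
move=> m0 /andP[t0 t1]; have mt0 : 0 <= m%:R * t by rewrite mulr_ge0.
have /andP[lo hi] := truncn_itv mt0.
have [lt|ge] := ltnP (Num.truncn (m%:R * t)) m.
  by exists (Num.truncn (m%:R * t)); split=> //; exact: ltW.
exists m.-1; rewrite ltn_predL prednK//; split=> //.
  by rewrite (le_trans _ lo)// ler_nat (leq_trans (leq_pred m)).
by rewrite ler_piMr.
Qed.

Lemma matching_segments n q :
  matching n (fun j (t : R) => (1 - t) *: q j + t *: q j.+1).
Proof.
by move=> a _; rewrite subrr subr0 !scale0r !scale1r add0r addr0.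
Qed.

Lemma polylineE n q a (t : R) : (a < n)%N ->
  a%:R <= n%:R * t -> n%:R * t <= a.+1%:R ->
  polyline n q t = q a + (n%:R * t - a%:R) *: delta q a.
Proof.
move=> an ta at_; rewrite /polyline (concat_curvesE _ an)//.
  by rewrite /delta scalerBl scale1r scalerBr addrAC addrA.
exact: matching_segments.
Qed.

Lemma polyline0 n q : (0 < n)%N -> polyline n q 0 = q 0%N.
Proof.
by move=> n0; rewrite (@polylineE _ _ 0)// mulr0// subrr scale0r addr0.
Qed.

Lemma polyline1 n q : (0 < n)%N -> polyline n q 1 = q n.
Proof.
case: n => // n _; rewrite (@polylineE _ _ n)// mulr1 ?ler_nat//.
by rewrite -natrB// subSnn scale1r /delta addrC subrK.
Qed.

Lemma matching_bezier m n P : joined m n P ->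
  matching m (fun s => @bezier R V n (P s)).
Proof. by move=> hP a am; rewrite bezier1 bezier0 hP. Qed.

Lemma matching_polyline m n P : (0 < n)%N -> joined m n P ->
  matching m (fun s => @polyline R V n (P s)).
Proof. by move=> n0 hP a am; rewrite polyline1// polyline0// hP. Qed.

Lemma joined_subdivide m n P :
  joined m n P -> joined (2 * m) n (subdivide n P).
Proof.
move=> hP a am; rewrite /subdivide /=.
case: ifPn => odda /=.
  rewrite subdiv_rightE subnn mul1r umbralXn subdiv_leftE umbral1.
  rewrite hP; last by lia.
  by congr (P _ _); lia.
by rewrite subdiv_leftE subdiv_rightE subn0 mulr1; congr (umbral (P _) _); lia.
Qed.

Lemma composite_bezier_subdivide m n P (t : R) : (0 < m)%N -> joined m n P ->
  0 <= t <= 1 ->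
  composite_bezier (2 * m) n (subdivide n P) t = composite_bezier m n P t.
Proof.
move=> m0 hP t01; have m20 : (0 < 2 * m)%N by rewrite muln_gt0.
have [a [am ta at_]] := piece_exists m20 t01.
rewrite /composite_bezier.
rewrite (concat_curvesE (matching_bezier (joined_subdivide hP)) am ta at_).
have aE := odd_double_half a.
have aR : a%:R = (odd a)%:R + 2 * (a./2)%:R :> R.
  by rewrite -{1}aE natrD -mul2n natrM.
rewrite natrM aR; move: ta; rewrite natrM aR => ta.
move: at_; rewrite -natr1 natrM aR => at_.
rewrite (@concat_curvesE _ _ a./2)//.
- rewrite /subdivide; case: (odd a) => /=.
    by rewrite bezier_subdiv_right; congr bezier; field.
  by rewrite bezier_subdiv_left; congr bezier; field.
- exact: matching_bezier.
- by lia.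
- by move: ta; case: (odd a) => /=; lra.
- by move: at_; rewrite -natr1; case: (odd a) => /=; lra.
Qed.
End Concatenation.

(** * The distance from the control polygon to the curve *)

Section Estimates.
Context {R : realType} {V : normedModType R}.
Implicit Types (P : nat -> nat -> V) (q : nat -> V).

Lemma subrACA (W : zmodType) (x y z w : W) :
  (x - y) - (z - w) = (x - z) - (y - w).
Proof. by rewrite !opprB addrACA [RHS]addrACA [- y - z]addrC. Qed.

(** Insert the break points between s and t: the lengths of the parameter
    intervals add up. *)
Lemma lipschitz_glue m (F : R -> V) L : (0 < m)%N ->
  (forall a, (a < m)%N -> forall s t, a%:R <= m%:R * s -> s <= t ->
     m%:R * t <= a.+1%:R -> `|F t - F s| <= L * (t - s)) ->
  forall s t, 0 <= s -> s <= t -> t <= 1 -> `|F t - F s| <= L * (t - s).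
Proof.
move=> m0 FL; have mR : 0 < m%:R :> R by rewrite ltr0n.
suff H a : (a <= m)%N -> forall s t, 0 <= s -> s <= t ->
    m%:R * t <= a%:R -> `|F t - F s| <= L * (t - s).
  move=> s t s0 st t1; apply: (H m) => //.
  by rewrite ler_piMr// ltW.
elim: a => [|a IH] am s t s0 st ta.
  have -> : t = s.
    apply/le_anti; rewrite st andbT (le_trans _ s0)//.
    by rewrite -(ler_pM2l mR) mulr0.
  by rewrite !subrr normr0 mulr0.
have [sa|sa] := leP a%:R (m%:R * s); first exact: (FL a).
have [ta'|ta'] := leP (m%:R * t) a%:R; first by apply: IH => //; exact: ltnW.
have uE : m%:R * (a%:R / m%:R) = a%:R :> R by rewrite mulrC divfK// gt_eqF.
set u := a%:R / m%:R in uE.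
have su : s <= u by rewrite -(ler_pM2l mR) uE ltW.
have ut : u <= t by rewrite -(ler_pM2l mR) uE ltW.
have -> : F t - F s = (F t - F u) + (F u - F s) by rewrite addrA subrK.
have -> : L * (t - s) = L * (t - u) + L * (u - s) by ring.
rewrite (le_trans (ler_normD _ _))// lerD//.
  by apply: (FL a) => //; rewrite uE.
by apply: IH => //; rewrite ?uE//; exact: ltnW.
Qed.

(** The counterpart of [bezier_slope] for the polygon: after subtraction of
    the motion with velocity n v, each edge is short. *)
Lemma polyline_slope n q v M (s t : R) : (0 < n)%N ->
  0 <= s -> s <= t -> t <= 1 ->
  (forall j, (j < n)%N -> `|delta q j - v| <= M) ->
  `|polyline n q t - polyline n q s - (n%:R * (t - s)) *: v|
    <= n%:R * M * (t - s).
Proof.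
move=> n0 s0 st t1 qM.
pose F u := polyline n q u - (n%:R * u) *: v.
have -> : polyline n q t - polyline n q s - (n%:R * (t - s)) *: v = F t - F s.
  by rewrite /F subrACA -scalerBl mulrBr.
apply: (lipschitz_glue n0) => // a an x y ax xy ya.
have ay : a%:R <= n%:R * y by rewrite (le_trans ax)// ler_wpM2l.
have xa : n%:R * x <= a.+1%:R by rewrite (le_trans _ ya)// ler_wpM2l.
have -> : F y - F x = (n%:R * (y - x)) *: (delta q a - v).
  rewrite /F subrACA !(@polylineE _ _ _ _ a)// opprD addrACA subrr add0r.
  by rewrite -!scalerBl subrACA subrr subr0 -mulrBr [RHS]scalerBr.
rewrite normrZ ger0_norm; last by rewrite mulr_ge0// subr_ge0.
by rewrite [leRHS]mulrAC ler_wpM2l ?qM// mulr_ge0// subr_ge0.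
Qed.

Lemma delta_drift n q mu : (forall j, (j.+2 <= n)%N ->
    `|delta (delta q) j| <= mu) -> 0 <= mu ->
  forall j, (j < n)%N -> `|delta q j - delta q 0| <= n%:R * mu.
Proof.
move=> qmu mu0; suff H j : (j < n)%N -> `|delta q j - delta q 0| <= j%:R * mu.
  move=> j jn; rewrite (le_trans (H _ jn))// ler_wpM2r// ler_nat; exact: ltnW.
elim: j => [|j IH] jn; first by rewrite subrr normr0 mul0r.
have -> : delta q j.+1 - delta q 0
    = delta (delta q) j + (delta q j - delta q 0) by rewrite addrA subrK.
rewrite (le_trans (ler_normD _ _))// -addn1 natrD mulrDl mul1r addrC lerD//.
  by apply: IH; exact: ltnW.
exact: qmu.
Qed.

Definition bend m n P mu : Prop :=
  forall a j, (a < m)%N -> (j.+2 <= n)%N -> `|delta (delta (P a)) j| <= mu.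

Lemma bend_subdivide m n P mu : bend m n P mu ->
  bend (2 * m) n (subdivide n P) (4^-1 * mu).
Proof.
move=> Pmu a j am jn; rewrite /subdivide.
have Pa k : (k.+2 <= n)%N -> `|delta (delta (P a./2)) k| <= mu.
  by move=> kn; apply: Pmu => //; lia.
case: ifP => _.
  rewrite delta2_subdiv_right// normrZ ger0_norm// ler_wpM2l//.
  apply: norm_umbral_le (averageM (averageXn _ average_mid)
                                  (averageXn _ averageX)) _ => k kn.
  by apply: Pa; lia.
rewrite delta2_subdiv_left// normrZ ger0_norm// ler_wpM2l//.
apply: norm_umbral_le (averageXn _ average_mid) _ => k kn.
by apply: Pa; lia.
Qed.

(** On each piece compare both curves with the uniform motion whose velocity is
    n times the first edge; the factor m comes from the reparametrization of
    the pieces. *)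
Lemma polygon_near_bezier m n P mu : (0 < m)%N -> (0 < n)%N ->
  joined m n P -> bend m n P mu -> 0 <= mu ->
  let D t := composite_polyline m n P t - composite_bezier m n P t in
  forall s t, 0 <= s -> s <= t -> t <= 1 ->
    `|D t - D s| <= (2 * n%:R ^+ 2 * (m%:R * mu)) * (t - s).
Proof.
move=> m0 n0 hP Pmu mu0 D s t s0 st t1.
apply: (lipschitz_glue m0) => // a am x y ax xy ya.
have ay : a%:R <= m%:R * y by rewrite (le_trans ax)// ler_wpM2l.
have xa : m%:R * x <= a.+1%:R by rewrite (le_trans _ ya)// ler_wpM2l.
rewrite /D /composite_polyline /composite_bezier.
rewrite !(concat_curvesE (matching_polyline n0 hP) am)//.
rewrite !(concat_curvesE (matching_bezier hP) am)//.
set q := P a; set x' := _ * x - _; set y' := _ * y - _.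
have xy' : x' <= y' by rewrite lerB// ler_wpM2l.
have x'0 : 0 <= x' by rewrite subr_ge0.
have y'1 : y' <= 1 by rewrite lerBlDr addrC natr1.
(* Local parameters x' and y' in piece a; its first edge is the reference
   velocity. *)
have drift := delta_drift (fun j => Pmu a j am) mu0.
have h1 := polyline_slope n0 x'0 xy' y'1 drift.
have h2 : `|bezier n q y' - bezier n q x' - (n%:R * (y' - x')) *: delta q 0|
    <= n%:R * (n%:R * mu) * `|y' - x'|.
  by apply: bezier_slope drift; apply/andP; split; lra.
rewrite ger0_norm ?subr_ge0// in h2.
have -> : 2 * n%:R ^+ 2 * (m%:R * mu) * (y - x) =
  n%:R * (n%:R * mu) * (y' - x') + n%:R * (n%:R * mu) * (y' - x').
  by rewrite /x' /y'; ring.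
apply: le_trans (lerD h1 h2); apply: le_trans _ (ler_normB _ _).
by rewrite [X in _ <= `|X|]subrACA subrr subr0 subrACA.
Qed.

Lemma subdivided_props m n P mu i : (0 < m)%N -> joined m n P ->
  bend m n P mu ->
  [/\ joined (m * 2 ^ i) n (subdivided n P i),
      bend (m * 2 ^ i) n (subdivided n P i) (4^-1 ^+ i * mu)
    & forall t : R, 0 <= t <= 1 ->
        composite_bezier (m * 2 ^ i) n (subdivided n P i) t
          = composite_bezier m n P t].
Proof.
move=> m0 hP Pmu; elim: i => [|i [IHj IHb IHe]].
  by rewrite expn0 muln1 expr0 mul1r.
have -> : (m * 2 ^ i.+1 = 2 * (m * 2 ^ i))%N by rewrite expnS mulnCA.
rewrite /subdivided iterS -/(subdivided n P i) exprS -mulrA; split.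
- exact: joined_subdivide.
- exact: bend_subdivide.
- move=> t t01; rewrite composite_bezier_subdivide ?IHe//.
  by rewrite muln_gt0 m0 expn_gt0.
Qed.

End Estimates.

(** * Lipschitz comparison and homeomorphism *)

Section WithinContinuity.
Context {R : realType} {V W : normedModType R}.

Lemma within_continuousP (A : set V) (f : V -> W) :
  {within A, continuous f} <->
  forall x, A x -> forall e : R, 0 < e -> exists2 d : R, 0 < d &
    forall u, A u -> `|x - u| < d -> `|f x - f u| < e.
Proof.
split=> [/subspace_continuousP fA x Ax e e0|fA].
  have /cvgrPdist_lt/(_ _ e0) := fA x Ax.
  rewrite /prop_near1 /within /= => /nbhs_ballP[d /= d0 dP].
  exists d => // u Au xu; apply: dP => //.
  by rewrite -ball_normE.
apply/subspace_continuousP => x Ax; apply/cvgrPdist_lt => e e0.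
have [d d0 dP] := fA x Ax e e0.
rewrite /prop_near1 /within /=; apply/nbhs_ballP; exists d => //= u.
by rewrite -ball_normE => /= xu Au; exact: dP.
Qed.
End WithinContinuity.

Section Transfer.
Context {R : realType} {V : normedModType R}.

(** The estimate forces f to be constant on the fibres of g, so f factors
    through g, and the factor is Lipschitz. *)
Lemma lipschitz_transfer (S : set R) (f g : R -> V) (a : R) : 0 < a ->
  (forall s t, S s -> S t -> `|f s - f t| <= a * `|g s - g t|) ->
  exists phi : V -> V, (forall t, S t -> phi (g t) = f t) /\
    {within g @` S, continuous phi}.
Proof.
move=> a0 fg; pose phi y := f (xget 0 [set t | S t /\ g t = y]).
have phig t : S t -> phi (g t) = f t.
  move=> St; rewrite /phi; case: xgetP => [u _ [Su gu]|/(_ t)[]//].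
  have := fg _ _ Su St.
  by rewrite gu subrr normr0 mulr0 normr_le0 subr_eq0 => /eqP.
exists phi; split=> //; apply/within_continuousP => _ [x Sx <-] e e0.
exists (e / a); first exact: divr_gt0.
move=> _ [u Su <-]; rewrite !phig// ltr_pdivlMr// mulrC.
exact: le_lt_trans (fg _ _ Sx Su).
Qed.

Lemma homeomorphic_images (S : set R) (f g : R -> V) (a b : R) :
  0 < a -> 0 < b ->
  (forall s t, S s -> S t -> `|f s - f t| <= a * `|g s - g t|) ->
  (forall s t, S s -> S t -> `|g s - g t| <= b * `|f s - f t|) ->
  homeomorphic (g @` S) (f @` S).
Proof.
move=> a0 b0 fg gf.
have [phi [phiE phic]] := lipschitz_transfer a0 fg.
have [psi [psiE psic]] := lipschitz_transfer b0 gf.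
exists phi, psi; split=> //; split.
- by move=> _ [t St <-]; rewrite phiE//; exists t.
- by move=> _ [t St <-]; rewrite psiE//; exists t.
- by move=> y /set_mem[t St <-]; rewrite phiE// psiE.
- by move=> y /set_mem[t St <-]; rewrite psiE// phiE.
Qed.
End Transfer.

(** * The mean value inequality for curves on the unit interval *)

Section Differentiation.
Context {R : realType} {k : nat}.
Implicit Types (f df : R -> 'rV[R]_k).

Lemma norm_coord_le (v : 'rV[R]_k) j : `|v 0 j| <= `|v|.
Proof.
rewrite [leRHS]mx_normrE.
exact: (le_bigmax _ (fun i : 'I_1 * 'I_k => `|v i.1 i.2|) (0, j)).
Qed.

Lemma norm_row_le (v : 'rV[R]_k) (M : R) : 0 <= M ->
  (forall j, `|v 0 j| <= M) -> `|v| <= M.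
Proof.
move=> M0 vM; rewrite [leLHS]mx_normrE; apply: bigmax_le => // -[i j] _ /=.
by rewrite ord1.
Qed.

Lemma has_deriv01_approx f (t : R) (v : 'rV[R]_k) : has_deriv01 f t v ->
  forall e : R, 0 < e -> exists2 d : R, 0 < d &
    forall u, 0 <= u <= 1 -> `|t - u| < d ->
      `|f u - f t - (u - t) *: v| <= e * `|u - t|.
Proof.
move=> /cvgrPdist_le dv e e0; have := dv e e0.
rewrite /prop_near1 /within /dnbhs /= => /nbhs_ballP[d /= d0 dP].
exists d => // u u01 tu.
have [->|ut] := eqVneq u t; first by rewrite !subrr scale0r subrr !normr0 mulr0.
have ut0 : u - t != 0 by rewrite subr_eq0.
have := dP u; rewrite -ball_normE /= => /(_ tu ut).
rewrite in_itv /= => /(_ u01) vu.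
have -> : f u - f t - (u - t) *: v
    = - ((u - t) *: (v - (u - t)^-1 *: (f u - f t))).
  by rewrite scalerBr scalerA mulfV// scale1r opprB.
by rewrite normrN normrZ mulrC ler_wpM2r.
Qed.

Lemma has_deriv01_continuous f (t : R) (v : 'rV[R]_k) : has_deriv01 f t v ->
  forall e : R, 0 < e -> exists2 d : R, 0 < d &
    forall u, 0 <= u <= 1 -> `|t - u| < d -> `|f t - f u| < e.
Proof.
move=> /has_deriv01_approx/(_ 1 ltr01)[d d0 dP] e e0.
have v1 : 0 < 1 + `|v| by rewrite ltr_pwDl.
exists (Num.min d (e / (1 + `|v|))); first by rewrite lt_min d0 divr_gt0.
move=> u u01; rewrite lt_min => /andP[tu]; rewrite ltr_pdivlMr// => tue.
apply: le_lt_trans tue; rewrite distrC -(subrK ((u - t) *: v) (f u - f t)).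
rewrite (le_trans (ler_normD _ _))// mulrDr mulr1 [`|t - u|]distrC lerD//.
  by have := dP u u01 tu; rewrite mul1r.
by rewrite normrZ.
Qed.

Lemma is_derive_coord f (t : R) (v : 'rV[R]_k) j : 0 < t -> t < 1 ->
  has_deriv01 f t v -> is_derive t 1 (fun u => f u 0 j) (v 0 j).
Proof.
move=> t0 t1 /has_deriv01_approx fv.
suff H : h^-1 *: (f (h *: 1 + t) 0 j - f t 0 j) @[h --> 0^'] --> v 0 j.
  by apply: DeriveDef; [apply/cvg_ex; exists (v 0 j)|exact: cvg_lim].
apply/cvgrPdist_le => e e0; have [d d0 dP] := fv e e0.
rewrite /prop_near1 /dnbhs /within /=; apply/nbhs_ballP.
exists (Num.min d (Num.min t (1 - t))); first by rewrite /= !lt_min d0 t0 subr_gt0.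
move=> h; rewrite -ball_normE /= sub0r normrN !lt_min => /and3P[hd ht ht1] h0.
have h01 : 0 <= h + t <= 1.
  by apply/andP; split; move: ht ht1; rewrite !ltr_norml; lra.
have := dP _ h01; rewrite opprD addrCA subrr addr0 normrN addrK => /(_ hd) H.
rewrite [h *: 1]mulr1.
have -> : v 0 j - h^-1 *: (f (h + t) 0 j - f t 0 j)
   = - h^-1 * (f (h + t) - f t - h *: v) 0 j.
  by rewrite !mxE /GRing.scale /=; field.
rewrite normrM normrN normfV mulrC ler_pdivrMr ?normr_gt0//.
exact: le_trans (norm_coord_le _ _) H.
Qed.

(** With the supremum norm the inequality can be checked on each coordinate,
    where it follows from the mean value theorem. *)
Lemma mean_value_le f df (s t M : R) (v : 'rV[R]_k) :
  (forall u, u \in `[0, 1] -> has_deriv01 f u (df u)) ->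
  0 <= s -> s <= t -> t <= 1 ->
  (forall u, s <= u -> u <= t -> `|df u - v| <= M) ->
  `|f t - f s - (t - s) *: v| <= M * (t - s).
Proof.
move=> fdf s0; rewrite le_eqVlt => /predU1P[-> _ _|st t1 dfM].
  by rewrite !subrr scale0r subrr normr0 mulr0.
have M0 : 0 <= M by apply: le_trans (dfM s _ _) => //; exact: ltW.
apply: norm_row_le; first by rewrite mulr_ge0// subr_ge0 ltW.
move=> j; pose g u := f u 0 j.
have [||c] := @MVT R g (fun u => df u 0 j) s t st.
- move=> x; rewrite in_itv /= => /andP[sx xt].
  apply: is_derive_coord; [lra|lra|].
  by apply: fdf; rewrite in_itv /=; apply/andP; split; lra.
- apply/within_continuousP => x /=; rewrite in_itv /= => /andP[sx xt] e e0.
  have x01 : x \in `[0, 1] by rewrite in_itv /=; apply/andP; split; lra.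
  have [d d0 dP] := has_deriv01_continuous (fdf x x01) e0.
  exists d => // u; rewrite /= in_itv /= => /andP[su ut] xu.
  have := dP u _ xu; rewrite /g => H.
  have := norm_coord_le (f x - f u) j; rewrite !mxE => /le_lt_trans; apply.
  by apply: H; apply/andP; split; lra.
rewrite in_itv /= => /andP[sc ct]; rewrite /g => gE.
have -> : (f t - f s - (t - s) *: v) 0 j = (df c - v) 0 j * (t - s).
  by rewrite !mxE gE; ring.
have ts0 : 0 <= t - s by rewrite subr_ge0 ltW.
rewrite normrM [`|t - s|]ger0_norm// ler_wpM2r//.
by apply: le_trans (norm_coord_le _ _) _; apply: dfM; exact: ltW.
Qed.
End Differentiation.

(** * The chord-arc inequality *)

Section ChordArc.
Context {R : realType}.

(** The second alternative takes the short way around a closed curve, through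
    the common end point. *)
Definition chord_bound k (f : R -> 'rV[R]_k) (c s t : R) : Prop :=
  0 <= s -> s <= t -> t <= 1 ->
    c * (t - s) <= `|f t - f s| \/
    closed_curve f /\ c * (1 - (t - s)) <= `|f t - f s|.

(** A bound which holds locally with some constant holds globally on a compact
    set with one constant. *)
Lemma unit_square_uniform (P : R -> R -> R -> Prop) :
  (forall c c' s t, c' <= c -> P c s t -> P c' s t) ->
  (forall s0 t0, 0 <= s0 <= 1 -> 0 <= t0 <= 1 ->
     exists d c : R, [/\ 0 < d, 0 < c & forall s t,
       `|s0 - s| < d -> `|t0 - t| < d -> P c s t]) ->
  exists2 c, 0 < c & forall s t, 0 <= s <= 1 -> 0 <= t <= 1 -> P c s t.
Proof.
move=> Pmono Ploc.
have : compact (`[0, 1]%classic `*` `[0, 1]%classic : set (R * R)).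
  by apply: compact_setX; exact: segment_compact.
move=> /compact_near_coveringP.
move=> /(_ R 0^'+ (fun c z => P c z.1 z.2) _) cov.
have : \forall c \near (0:R)^'+,
    `[0, 1]%classic `*` `[0, 1]%classic `<=` (fun z : R * R => P c z.1 z.2).
  apply: cov => -[s0 t0] [] /=; rewrite !in_itv /= => s01 t01.
  have [d [c [d0 c0 dP]]] := Ploc _ _ s01 t01.
  exists (ball (s0, t0) d, [set c' | c' <= c]).
    by split; [exact: nbhsx_ballx|exact: nbhs_right_le].
  move=> [[s t] c'] [[/= sd td]] c'c.
  by apply: Pmono c'c _; apply: dP; move: sd td; rewrite -ball_normE.
move=> cP; have [c [c0 Pc]] : exists c, 0 < c /\
    `[0, 1]%classic `*` `[0, 1]%classic `<=` (fun z : R * R => P c z.1 z.2).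
  near (0:R)^'+ => c; exists c; split; first by near: c; exact: nbhs_right_gt.
  by near: c.
exists c => // s t s01 t01; apply: (Pc (s, t)).
by split; rewrite /= in_itv.
Unshelve. all: by end_near. Qed.

Section LocalBounds.
Context {k : nat} (f df : R -> 'rV[R]_k).
Hypothesis fdf : forall t : R, t \in `[0, 1] -> has_deriv01 f t (df t).
Hypothesis df_neq0 : forall x : R, 0 <= x <= 1 -> df x != 0.
Hypothesis df_cont : {within `[0, 1], continuous df}.

Let slope_gt0 (x : R) : 0 <= x <= 1 -> 0 < `|df x| / 2.
Proof. by move=> x01; rewrite divr_gt0 ?normr_gt0 ?df_neq0. Qed.

Let df_near (x : R) : 0 <= x <= 1 ->
  exists2 d : R, 0 < d & forall u : R, 0 <= u <= 1 ->
    `|x - u| < d -> `|df u - df x| <= `|df x| / 2.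
Proof.
move=> x01; move/within_continuousP: df_cont => /(_ x); rewrite /= in_itv /=.
move=> /(_ x01 _ (slope_gt0 x01))[d d0 dP]; exists d => // u u01 xu.
by rewrite distrC ltW// dP//= in_itv.
Qed.

(** Close to x all derivatives are within |df x| / 2 of df x, hence so are the
    chord slopes. *)
Lemma chord_near_diagonal (x : R) : 0 <= x <= 1 ->
  exists d c : R, [/\ 0 < d, 0 < c & forall s t : R,
    `|x - s| < d -> `|x - t| < d -> chord_bound f c s t].
Proof.
move=> x01; have [d d0 dP] := df_near x01.
exists d, (`|df x| / 2); split=> //; first exact: slope_gt0.
move=> s t sd td s0 st t1; left.
have dfx u : s <= u -> u <= t -> `|df u - df x| <= `|df x| / 2.
  move=> su ut; apply: dP; first by apply/andP; split; lra.
  move: sd td; rewrite !ltr_norml => /andP[? ?] /andP[? ?].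
  by apply/andP; split; lra.
have H := mean_value_le fdf s0 st t1 dfx.
have := lerB_dist ((t - s) *: df x) (f t - f s).
rewrite normrZ ger0_norm ?subr_ge0// distrC => H'.
by move: (le_trans H' H); lra.
Qed.

Lemma chord_near_distinct (x y : R) : 0 <= x <= 1 -> 0 <= y <= 1 ->
  f x != f y -> exists d c : R, [/\ 0 < d, 0 < c & forall s t : R,
    `|x - s| < d -> `|y - t| < d -> chord_bound f c s t].
Proof.
move=> x01 y01 fxy.
have r0 : 0 < `|f y - f x| / 3 by rewrite divr_gt0// normr_gt0 subr_eq0 eq_sym.
have [d1 d10 d1P] := has_deriv01_continuous (fdf x01) r0.
have [d2 d20 d2P] := has_deriv01_continuous (fdf y01) r0.
exists (Num.min d1 d2), (`|f y - f x| / 3); split=> //.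
  by rewrite lt_min d10.
move=> s t; rewrite !lt_min => /andP[sd _] /andP[_ td] s0 st t1; left.
have {}sd : `|f x - f s| < `|f y - f x| / 3.
  by apply: d1P sd; apply/andP; split; lra.
have {}td : `|f y - f t| < `|f y - f x| / 3.
  by apply: d2P td; apply/andP; split; lra.
have : `|f y - f x| <= `|f y - f t| + `|f t - f s| + `|f x - f s|.
  rewrite [`|f x - f s|]distrC -[f y - f x](subrKA (f s)).
  rewrite (le_trans (ler_normD _ _))// lerD2r.
  by rewrite -[f y - f s](subrKA (f t)) ler_normD.
have : `|f y - f x| / 3 * (t - s) <= `|f y - f x| / 3.
  by rewrite (ler_piMr (ltW r0))//; lra.
by lra.
Qed.

(** The chord from s to t is minus the sum of the short arcs from t to 1 and
    from 0 to s, whose slopes are both close to df 0 = df 1. *)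
Lemma chord_near_corner : closed_curve f -> df 0 = df 1 ->
  exists d c : R, [/\ 0 < d, 0 < c & forall s t : R,
    `|0 - s| < d -> `|1 - t| < d -> chord_bound f c s t].
Proof.
move=> f01 df01.
have [|d1 d10 d1P] := @df_near 0; first by rewrite lexx ler01.
have [|d2 d20 d2P] := @df_near 1; first by rewrite lexx ler01.
exists (Num.min d1 d2), (`|df 0| / 2); split.
- by rewrite lt_min d10.
- by apply: slope_gt0; rewrite lexx ler01.
move=> s t; rewrite !lt_min sub0r normrN => /andP[sd _] /andP[_ td] s0 st t1.
right; split=> //.
rewrite ger0_norm// in sd; rewrite ger0_norm ?subr_ge0// in td.
have s1 : s <= 1 := le_trans st t1.
have t0 : 0 <= t := le_trans s0 st.
have dfs u : 0 <= u -> u <= s -> `|df u - df 0| <= `|df 0| / 2.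
  move=> u0 us; apply: d1P; first by rewrite u0 (le_trans us).
  by rewrite sub0r normrN ger0_norm// (le_lt_trans us).
have dft u : t <= u -> u <= 1 -> `|df u - df 0| <= `|df 0| / 2.
  move=> tu u1; rewrite df01; apply: d2P; first by rewrite u1 (le_trans t0).
  by rewrite ger0_norm ?subr_ge0// (le_lt_trans _ td)// lerB.
have := lerD (mean_value_le fdf (lexx 0) s0 s1 dfs)
             (mean_value_le fdf t0 t1 (lexx 1) dft).
move=> /(le_trans (ler_normD _ _)).
have -> : f s - f 0 - (s - 0) *: df 0 + (f 1 - f t - (1 - t) *: df 0)
    = - (f t - f s) - (1 - (t - s)) *: df 0.
  rewrite f01 addrACA -opprD -scalerDl opprB; congr (_ - _ *: _); last by ring.
  by rewrite addrA subrK.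
rewrite distrC => H.
have := lerB_dist ((1 - (t - s)) *: df 0) (- (f t - f s)).
rewrite normrZ ger0_norm; last first.
  by rewrite opprB addrCA addr_ge0// subr_ge0.
by rewrite normrN => H'; clear -H H'; move: (le_trans H' H); lra.
Qed.
End LocalBounds.

(** By compactness it is enough to work near a pair of parameters (x, y): either
    x = y and regularity applies, or f x and f y differ, or simplicity says
    that the curve is closed and x, y are its end parameters. *)
Lemma chord_arc k (f : R -> 'rV[R]_k) :
  simple_curve f -> regular_curve f -> C1_curve f ->
  exists2 c : R, 0 < c & forall s t, chord_bound f c s t.
Proof.
move=> fsimple fregular [df [fdf df_cont df01]].
have df_neq0 x : 0 <= x <= 1 -> df x != 0.
  by move=> x01; apply: fregular (fdf x x01); rewrite in_itv.
have [||c c0 Pc] := @unit_square_uniform (chord_bound f).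
- move=> c c' s t cc' H s0 st t1; case: (H s0 st t1) => [H'|[f01 H']].
    by left; apply: le_trans H'; rewrite ler_wpM2r//; lra.
  by right; split=> //; apply: le_trans H'; rewrite ler_wpM2r//; lra.
- move=> x y x01 y01.
  have [<-|xy] := eqVneq x y; first exact: chord_near_diagonal fdf _ _ _ _.
  have [fxy|] := eqVneq (f x) (f y); last exact: chord_near_distinct fdf _ _ _ _.
  move: x01 y01 => /andP[x0 x1] /andP[y0 y1].
  have [ltxy|leyx] := ltP x y.
    have [xE yE] := fsimple x y x0 ltxy y1 fxy.
    rewrite xE yE in fxy *.
    exact: chord_near_corner fdf df_neq0 df_cont fxy (df01 fxy).
  have ltyx : y < x by rewrite lt_neqAle eq_sym xy.
  have [-> ->] := fsimple y x y0 ltyx x1 (esym fxy).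
  (* Here x = 1 and y = 0, and no pair with s <= t is close to (1, 0). *)
  exists 2^-1, 1; split=> // s t; rewrite !ltr_norml => sd td _ st _.
  by exfalso; move: sd td st; clear; move=> /andP[_ s1] /andP[t0 _]; lra.
exists c => // s t s0 st t1.
by apply: Pc => //; apply/andP; split=> //; [exact: le_trans t1|exact: le_trans st].
Qed.

(** In the second alternative of [chord_bound] the displacement g - f, which
    vanishes at 0 and at 1, is estimated on [0, s] and on [t, 1]. *)
Lemma perturbation_comparable k (f g : R -> 'rV[R]_k) (c : R) :
  (forall s t, chord_bound f c s t) ->
  g 0 = f 0 -> g 1 = f 1 ->
  (forall s t, 0 <= s -> s <= t -> t <= 1 ->
     `|(g t - f t) - (g s - f s)| <= c / 2 * (t - s)) ->
  forall s t, 0 <= s <= 1 -> 0 <= t <= 1 ->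
    `|(g s - g t) - (f s - f t)| <= `|f s - f t| / 2.
Proof.
move=> chord g0 g1 gf s t s01 t01; wlog st : s t s01 t01 / s <= t => [H|].
  have [/H|/ltW ts] := leP s t; first exact.
  have := H t s t01 s01 ts; rewrite [`|f t - f s|]distrC.
  by rewrite -normrN opprB -[f t - f s]opprB -[g t - g s]opprB opprK addrC.
move: s01 t01 => /andP[s0 s1] /andP[t0 t1].
rewrite [`|f s - f t|]distrC subrACA [leLHS]distrC.
case: (chord s t s0 st t1) => [H|[f01 H]].
  by apply: le_trans (gf _ _ s0 st t1) _; lra.
have H1 := gf 0 s (lexx 0) s0 s1; have H2 := gf t 1 t0 t1 (lexx 1).
have := lerD H1 H2; rewrite g0 g1 !subrr subr0 sub0r normrN [X in X <= _]addrC => H'.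
apply: le_trans (ler_normB _ _) _; apply: le_trans H' _; lra.
Qed.

End ChordArc.

(** * Convergence of the control polygons *)

Section ControlPolygons.
Context {R : realType} {V : normedModType R}.
Implicit Types P : nat -> nat -> V.

Lemma bend_exists m n P : exists2 mu : R, 0 <= mu & bend m n P mu.
Proof.
exists (\sum_(a < m) \sum_(j < n) `|delta (delta (P a)) j|).
  by apply: sumr_ge0 => a _; exact: sumr_ge0.
move=> a j am jn; have jn' : (j < n)%N by lia.
rewrite (bigD1 (Ordinal am))//= (bigD1 (Ordinal jn'))//= -addrA lerDl.
by rewrite addr_ge0// ?sumr_ge0// => i _; exact: sumr_ge0.
Qed.

Lemma composite_endpoints m n P : (0 < m)%N -> (0 < n)%N -> joined m n P ->
  composite_polyline m n P 0 = composite_bezier m n P 0 /\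
  composite_polyline m n P 1 = composite_bezier m n P 1.
Proof.
case: m => // m _ n0 hP; rewrite /composite_polyline /composite_bezier; split.
  rewrite !(@concat_curvesE _ _ _ _ 0 0) ?mulr0//.
  - by rewrite subr0 polyline0// bezier0.
  - exact: matching_bezier.
  - exact: matching_polyline.
rewrite !(@concat_curvesE _ _ _ _ m 1) ?mulr1 ?ler_nat//.
- by rewrite -natrB// subSnn polyline1// bezier1.
- exact: matching_bezier.
- exact: matching_polyline.
Qed.

Lemma control_polygon_converges m n P (e : R) : (0 < m)%N -> (0 < n)%N ->
  joined m n P -> 0 < e ->
  exists i0 : nat, forall i, (i0 <= i)%N -> forall s t : R,
    0 <= s -> s <= t -> t <= 1 ->
    `|(control_polygon m n P i t - composite_bezier m n P t) -
      (control_polygon m n P i s - composite_bezier m n P s)| <= e * (t - s).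
Proof.
move=> m0 n0 hP e0; have [mu mu0 Pmu] := bend_exists m n P.
pose C := 2 * n%:R ^+ 2 * (m%:R * mu).
have C0 : 0 <= C by rewrite /C !mulr_ge0// exprn_ge0.
exists (Num.truncn (C / e)).+1 => i i0i s t s0 st t1.
have [hPi Pimu PiE] := subdivided_props i m0 hP Pmu.
have K0 : (0 < m * 2 ^ i)%N by rewrite muln_gt0 m0 expn_gt0.
have q0 : 0 <= 4^-1 ^+ i :> R by rewrite exprn_ge0.
have := polygon_near_bezier K0 n0 hPi Pimu (mulr_ge0 q0 mu0) s0 st t1.
rewrite /= !PiE; [|by apply/andP; split; lra..].
move=> /le_trans; apply; rewrite ler_wpM2r ?subr_ge0//.
have -> : 2 * n%:R ^+ 2 * ((m * 2 ^ i)%:R * (4^-1 ^+ i * mu)) = C / 2 ^+ i.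
  rewrite /C natrM natrX (_ : 4^-1 = 2^-1 * 2^-1 :> R); last by field.
  by rewrite exprMn exprVn; field; rewrite expf_neq0.
rewrite ler_pdivrMr ?exprn_gt0// mulrC -ler_pdivrMr//.
have : (i < 2 ^ i)%N by rewrite ltn_expl.
have /andP[_] := truncn_itv (divr_ge0 C0 (ltW e0)).
rewrite -(ltr_nat R) natrX => /ltW Ce /ltW; apply: le_trans.
by apply: le_trans Ce _; rewrite ler_nat.
Qed.
End ControlPolygons.

Theorem theorem5p2 (R : realType) (m n : nat) (p : nat -> nat -> 'rV[R]_3)
    (hm : (1 <= m)%N) (hn : (1 <= n)%N) (hp : joined m n p)
    (B_simple : simple_curve (composite_bezier m n p))
    (B_regular : regular_curve (composite_bezier m n p))
    (B_C1 : C1_curve (composite_bezier m n p)) :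
  exists i0 : nat, forall i : nat, (i0 <= i)%N ->
    simple_curve (control_polygon m n p i) /\
    homeomorphic (control_polygon m n p i @` `[0, 1])
                 (composite_bezier m n p @` `[0, 1]).
Proof.
have [c c0 chord] := chord_arc B_simple B_regular B_C1.
have c20 : 0 < c / 2 by rewrite divr_gt0.
have [i0 close] := control_polygon_converges hm hn hp c20.
exists i0 => i i0i.
have [mu _ Pmu] := bend_exists m n p.
have [hPi _ PiE] := subdivided_props i hm hp Pmu.
have K0 : (0 < m * 2 ^ i)%N by rewrite muln_gt0 hm expn_gt0.
have [] := composite_endpoints K0 hn hPi.
rewrite !PiE ?lexx ?ler01// => end0 end1.
have cmp := perturbation_comparable chord end0 end1 (close i i0i).
set g := control_polygon m n p i in cmp *; set f := composite_bezier m n p in cmp *.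
have fg s t : 0 <= s <= 1 -> 0 <= t <= 1 -> `|f s - f t| <= 2 * `|g s - g t|.
  move=> s01 t01; have := cmp s t s01 t01; rewrite distrC => H.
  by have := le_trans (lerB_dist _ _) H; lra.
have gf s t : 0 <= s <= 1 -> 0 <= t <= 1 -> `|g s - g t| <= 2 * `|f s - f t|.
  move=> s01 t01; have H := cmp s t s01 t01.
  by have := le_trans (lerB_dist _ _) H; have := normr_ge0 (f s - f t); lra.
split.
  move=> s t s0 st t1 gst; apply: (B_simple s t s0 st t1).
  have := fg s t; rewrite gst subrr normr0 mulr0 normr_le0 subr_eq0 => H.
  by apply/eqP; apply: H; apply/andP; split; lra.
by apply: (@homeomorphic_images _ _ _ f g 2 2).
Qed.
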